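(* Let $M\ge1$ be an integer, let $u$ be a regular (sufficiently smooth) function near $\mathbf 0\in\mathbb{R}^n$, and let $q$ be a polynomial in $n$ variables with $\deg q\ge M$ (depending on the cell size) such that, for all multi-indices with $1\le|\boldsymbol\alpha|\le M$, $$(\mathbf v(q))_{\boldsymbol\alpha}=\boldsymbol{\Delta}\mathbf{x}^{\boldsymbol\alpha-\mathbf 1}\int_{\Omega_0}\partial_{\boldsymbol\alpha}q(\mathbf x)\,d\mathbf x=\sum_{\substack{|\boldsymbol\beta|=0\\ \boldsymbol\beta\text{ even}}}^{M-|\boldsymbol\alpha|}\frac{\partial_{\boldsymbol\alpha+\boldsymbol\beta}u(\mathbf 0)}{2^{|\boldsymbol\beta|}(\boldsymbol\beta+\mathbf 1)!}\boldsymbol{\Delta}\mathbf{x}^{\boldsymbol\alpha+\boldsymbol\beta}+\mathcal{O}(\rho^{M+1}).$$ Let $I[q]=B_M+R[q]$ be the decomposition of the smoothness indicator of $q$ defined in the context, and let $n_{cp}$ be the order of the critical point of $u$ at $\mathbf 0$. If $n_{cp}\ge M$, then $B_M=0$ and $R[q]=\mathcal{O}(\rho^{2M+2})$. If $n_{cp}<M$, then $B_M=\mathcal{O}(\rho^{2(n_{cp}+1)})$ and $R[q]=\mathcal{O}(\rho^{M+2+n_{cp}})$, so that $R[q]=o(B_M)$.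
   Context: Multi-index notation: for $\boldsymbol\alpha\in\mathbb{N}^n$, $|\boldsymbol\alpha|=\sum_i\alpha_i$, $\boldsymbol\alpha!=\prod_i\alpha_i!$, $\mathbf{x}^{\boldsymbol\alpha}=\prod_i x_i^{\alpha_i}$, $\partial_{\boldsymbol\alpha}$ is the partial derivative of multi-order $\boldsymbol\alpha$, $\mathbf 1=(1,\dots,1)$; $\boldsymbol\alpha$ is even if every $\alpha_i$ is even. $\Omega_0=\prod_{i=1}^n[-\Delta x_i/2,\Delta x_i/2]$ is the cell centred at $\mathbf 0$ of a Cartesian grid, with side lengths $\boldsymbol{\Delta}\mathbf{x}=(\Delta x_1,\dots,\Delta x_n)$ and diameter $\rho=\|\boldsymbol{\Delta}\mathbf{x}\|_2$; asymptotic statements are for $\rho\to0$. A smooth enough function $u$ has a critical point of order $n_{cp}$ at $\mathbf 0$ if $\partial_{\boldsymbol\alpha}u(\mathbf 0)=0$ for all $1\le|\boldsymbol\alpha|\le n_{cp}$ and $\partial_{\boldsymbol\alpha}u(\mathbf 0)\neq0$ for at least one $\boldsymbol\alpha$ with $|\boldsymbol\alpha|=n_{cp}+1$ (so $n_{cp}=0$ means that the gradient at $\mathbf 0$ is nonzero). The smoothness indicator of a polynomial $q$ of degree $d$ is $I[q]=\sum_{1\le|\boldsymbol\beta|\le d}\boldsymbol{\Delta}\mathbf{x}^{2\boldsymbol\beta-\mathbf 1}\int_{\Omega_0}(\partial_{\boldsymbol\beta}q(\mathbf{x}))^2\,d\mathbf{x}$. The vector $\mathbf v(q)$, indexed by the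 multi-indices with $|\boldsymbol\alpha|\le d$, has components $(\mathbf v(q))_{\boldsymbol\alpha}=\boldsymbol{\Delta}\mathbf{x}^{\boldsymbol\alpha-\mathbf 1}\int_{\Omega_0}\partial_{\boldsymbol\alpha}q\,d\mathbf{x}$. There is a constant, symmetric, positive semi-definite matrix $\mathbf C$ (depending only on $n$ and $d$) such that $I[q]=\langle\mathbf v(q),\mathbf C\,\mathbf v(q)\rangle$. Define $\mathbf v^{B_M}$ by $$(\mathbf v^{B_M})_{\boldsymbol\alpha}=\sum_{\substack{|\boldsymbol\beta|=0\\ \boldsymbol\beta\text{ even}}}^{M-|\boldsymbol\alpha|}\frac{\partial_{\boldsymbol\alpha+\boldsymbol\beta}u(\mathbf 0)}{2^{|\boldsymbol\beta|}(\boldsymbol\beta+\mathbf 1)!}\boldsymbol{\Delta}\mathbf{x}^{\boldsymbol\alpha+\boldsymbol\beta}\ \text{ if }1\le|\boldsymbol\alpha|\le M,\qquad (\mathbf v^{B_M})_{\boldsymbol\alpha}=0\ \text{ if }|\boldsymbol\alpha|=0\text{ or }|\boldsymbol\alpha|>M.$$ Then $B_M:=\langle\mathbf v^{B_M},\mathbf C\,\mathbf v^{B_M}\rangle$, which does not depend on $q$ except through its degree, and $R[q]:=I[q]-B_M=2\langle\mathbf v^{B_M},\mathbf C\mathbf v^{R[q]}\rangle+\langle\mathbf v^{R[q]},\mathbf C\mathbf v^{R[q]}\rangle$ with $\mathbf v^{R[q]}=\mathbf v(q)-\mathbf v^{B_M}$.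
   Formalization: Added since the claim fails otherwise: deg q stays bounded and the components of v(q) with |α| > M are O(ρ^{M+1}); and, for R[q] = o(B_M) only, the ratios of the cell sides Δx_i/Δx_j stay bounded as ρ→0. *)

(* Defs.v *)
(* mpoly is not imported in full: some of its notations clash with those of
   MathComp-Analysis. *)
From HB Require Import structures.
From mathcomp Require Import all_boot all_order all_algebra.
From mathcomp Require Import all_classical all_reals all_analysis.
From mathcomp Require mpoly.
Import (coercions, canonicals) mpoly.

Set Implicit Arguments.
Unset Strict Implicit.
Unset Printing Implicit Defensive.

Import Order.TTheory GRing.Theory Num.Theory.
Import numFieldNormedType.Exports.

Local Open Scope classical_set_scope.
Local Open Scope ring_scope.

Notation mindex n := (mpoly.multinom n).
Notation bmindex n b := (mpoly.bmultinom n b).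
Notation mdegree a := (mpoly.mdeg a).
Notation mvpoly R n := (mpoly.mpoly n R).
(* one plus the total degree, and 0 for the zero polynomial *)
Notation size_mvpoly q := (mpoly.mmeasure (@mpoly.mdeg _) q).

Definition evenm (n : nat) (b : mindex n) : bool := [forall i, ~~ odd (b i)].

Section Cell.
Context {R : realType} {n : nat}.
Implicit Types (D x : 'rV[R]_n) (q : mvpoly R n).

(* A cell is given by the row vector D of its side lengths. *)
Definition positive_cell D : Prop := forall i, 0 < D ord0 i.

(* The norm of MathComp-Analysis on 'rV_n is the sup norm, not this one. *)
Definition diameter D : R := Num.sqrt (\sum_i D ord0 i ^+ 2).

(* Integer exponents: those of D ^ (a - 1) and D ^ (2 a - 1) can be -1. *)
Definition cell_pow D (e : 'I_n -> int) : R := \prod_i D ord0 i ^ e i.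

Definition set_coord x (i : 'I_n) (t : R) : 'rV[R]_n :=
  \row_j (if j == i then t else x ord0 j).

(* MathComp-Analysis has no n-dimensional Lebesgue measure: the integral over
   the box is the iterated one, which by Fubini is the same thing for the
   (continuous) functions integrated below.  Every coordinate of the base
   point 0 is overwritten. *)
Definition cell_integral D (f : 'rV[R]_n -> R) : R :=
  foldr (fun i g x =>
           Rintegral lebesgue_measure
             `[- (D ord0 i / 2), D ord0 i / 2]%classic
             (fun t => g (set_coord x i t)))
    f (enum 'I_n) 0.

Definition eval_mvpoly q x : R := mpoly.meval (fun i => x ord0 i) q.

Definition smoothness_indicator D q : R :=
  \sum_(b : bmindex n (size_mvpoly q) | (0 < mdegree b)%N)
    cell_pow D (fun i => (b i)%:Z *+ 2 - 1)
    * cell_integral D (fun x => eval_mvpoly (mpoly.mderivm b q) x ^+ 2).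

Definition vec_poly D q (a : mindex n) : R :=
  cell_pow D (fun i => (a i)%:Z - 1)
  * cell_integral D (eval_mvpoly (mpoly.mderivm a q)).

(* Vectors v and matrices C have indices of mdegree at most d; v is given as a
   function of all multi-indices, of which only these are read. *)
Definition quad_form (d : nat) (C : bmindex n d.+1 -> bmindex n d.+1 -> R)
    (v : mindex n -> R) : R :=
  \sum_(a : bmindex n d.+1) v a * \sum_(b : bmindex n d.+1) C a b * v b.

(* These conditions determine C: for a given cell, q |-> vec_poly D q is a
   bijection from the polynomials of degree at most d to the vectors indexed
   by the multi-indices of mdegree at most d. *)
Definition indicator_matrix (d : nat)
    (C : bmindex n d.+1 -> bmindex n d.+1 -> R) : Prop :=
  [/\ forall a b, C a b = C b a,
      forall v, 0 <= quad_form C v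
    & forall D q, positive_cell D -> (size_mvpoly q <= d.+1)%N ->
        smoothness_indicator D q = quad_form C (vec_poly D q)].

Definition pderiv (i : 'I_n) (f : 'rV[R]_n -> R) : 'rV[R]_n -> R :=
  fun x => 'D_(delta_mx ord0 i) f x.

Definition pderivm (a : mindex n) (f : 'rV[R]_n -> R) : 'rV[R]_n -> R :=
  foldr (fun i => iter (a i) (pderiv i)) f (enum 'I_n).

(* Of class C^k near x0; 'D_ is total, hence the derivability clause. *)
Definition Ck_near (k : nat) (f : 'rV[R]_n -> R) (x0 : 'rV[R]_n) : Prop :=
  \forall x \near x0, forall s : seq 'I_n, (size s <= k)%N ->
    {for x, continuous (foldr pderiv f s)} /\
    ((size s < k)%N ->
       forall i, derivable (foldr pderiv f s) x (delta_mx ord0 i)).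

Definition critical_order (u : 'rV[R]_n -> R) (k : nat) : Prop :=
  (forall a : mindex n, (1 <= mdegree a <= k)%N -> pderivm a u 0 = 0) /\
  (exists2 a : mindex n, mdegree a = k.+1 & pderivm a u 0 != 0).

Definition taylor_average (u : 'rV[R]_n -> R) (M : nat) D (a : mindex n) : R :=
  \sum_(b : bmindex n (M - mdegree a).+1 | evenm b)
    pderivm (mpoly.mnm_add a b) u 0
    / (2 ^+ mdegree b * (\prod_i ((b i).+1)`!)%:R)
    * cell_pow D (fun i => (a i + b i)%:Z).

Definition vecB (u : 'rV[R]_n -> R) (M : nat) D (a : mindex n) : R :=
  if (1 <= mdegree a <= M)%N then taylor_average u M D a else 0.

Definition indicatorB (d : nat) (C : bmindex n d.+1 -> bmindex n d.+1 -> R)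
    (u : 'rV[R]_n -> R) (M : nat) D : R :=
  quad_form C (vecB u M D).

Definition indicatorR (d : nat) (C : bmindex n d.+1 -> bmindex n d.+1 -> R)
    (u : 'rV[R]_n -> R) (M : nat) D q : R :=
  smoothness_indicator D q - indicatorB C u M D.

Definition bounded_aspect_ratio (F : set_system 'rV[R]_n) : Prop :=
  exists kappa : R,
    \forall D \near F, forall i j, (D : 'rV[R]_n) ord0 i <= kappa * D ord0 j.

End Cell.

(* Main.v *)
Require Import Defs.
From HB Require Import structures.
From mathcomp Require Import all_boot all_order all_algebra.
From mathcomp Require Import all_classical all_reals all_analysis.
From mathcomp Require mpoly.
Import (coercions, canonicals) mpoly.

Import Order.TTheory GRing.Theory Num.Theory.
Import numFieldNormedType.Exports.

Local Open Scope classical_set_scope.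
Local Open Scope ring_scope.

(** Write [b v w] for the bilinear form of [C], [v_B] for [vecB u M D] and
[w = vec_poly D (q D) - v_B].  Expanding [I = b (v_B + w) (v_B + w)] gives
[R = 2 b v_B w + b w w].  All the estimates come from the sizes of the entries
of [v_B] and [w] in powers of the diameter [rho] of the cell.

The entry of [w] at the multi-index 0 is the mean of [q], which is not small.
It does not contribute: the indicator of a constant polynomial is 0, so the
basis vector at 0 is isotropic for a positive semi-definite form, hence lies
in its kernel ([indicator_matrix_row0]).  The other entries of [w] are
[O (rho ^ (M + 1))] by hypothesis.  In [v_B] every term carries a derivative
of [u] at 0 of some order [m] times a monomial of degree [m] in the side
lengths; derivatives of order up to [ncp] vanish, so the entries are
[O (rho ^ (ncp + 1))].  Multiplying these gives the bounds on [B] and [R].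

For [R = o(B)] a lower bound on [B] is required, that is, the definiteness of
[C] away from the multi-index 0.  It comes with an explicit constant
([quad_form_ge_sqr]): [v a ^ 2 <= quad_form C v] for every [v] and every
[1 <= |a| <= d].  On the unit cell, differentiation followed by averaging is
triangular on monomials, so every [v] is the vector of some polynomial [p]
([vec_poly_unit_surj]); then [quad_form C v] is the sum over the nonzero
multi-indices [b] of the mean of [(d_b p) ^ 2], and the mean of a square is at
least the square of the mean ([unit_cell_jensen]).  Since [C] is the same for
all cells, the bound then applies to the vector [v_B] of any cell.  Taking for
[a] a multi-index of order [ncp + 1] with nonzero derivative, the leading term
of [v_B] at [a] is that derivative times a monomial in the sides, which is
comparable to [rho ^ (ncp + 1)] when the aspect ratio is bounded.  So [B] is
at least a constant times [rho ^ (2 (ncp + 1))]. *)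

(** * Integrals of polynomials over a cell *)

Definition unit_cell {R : realType} {n : nat} : 'rV[R]_n := const_mx 1.

(** One step of the iterated integral: [cell_integral] is the fold of these
operators over all the coordinates. *)
Definition slab_integral {R : realType} {n : nat} (D : 'rV[R]_n) (i : 'I_n)
    (g : 'rV[R]_n -> R) : 'rV[R]_n -> R :=
  fun x => Rintegral lebesgue_measure
    `[- (D ord0 i / 2), D ord0 i / 2]%classic (fun t => g (set_coord x i t)).

Lemma eval_mvpolyP {R : realType} {n : nat} (c : R) (p r : mvpoly R n) x :
  eval_mvpoly (c *: p + r) x = c * eval_mvpoly p x + eval_mvpoly r x.
Proof. by rewrite /eval_mvpoly mpoly.mevalD mpoly.mevalZ. Qed.

Lemma eval_mvpolyX {R : realType} {n : nat} (m : mindex n) (x : 'rV[R]_n) :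
  eval_mvpoly (mpoly.mpolyX R m) x = \prod_i x ord0 i ^+ m i.
Proof. by rewrite /eval_mvpoly mpoly.mevalX. Qed.

Lemma eval_mvpoly0 {R : realType} {n : nat} (x : 'rV[R]_n) :
  eval_mvpoly 0 x = 0.
Proof. by rewrite /eval_mvpoly mpoly.meval0. Qed.

Lemma eval_mvpolyC {R : realType} {n : nat} (c : R) (x : 'rV[R]_n) :
  eval_mvpoly (mpoly.mpolyC n c) x = c.
Proof. by rewrite /eval_mvpoly mpoly.mevalC. Qed.

Lemma eval_mvpolyM {R : realType} {n : nat} (p r : mvpoly R n) x :
  eval_mvpoly (p * r) x = eval_mvpoly p x * eval_mvpoly r x.
Proof. by rewrite /eval_mvpoly mpoly.mevalM. Qed.

Lemma monomial_set_coord {R : realType} {n : nat} (m : mindex n)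
    (x : 'rV[R]_n) i t :
  eval_mvpoly (mpoly.mpolyX R m) (set_coord x i t) =
  (\prod_(j | j != i) x ord0 j ^+ m j) * t ^+ m i.
Proof.
rewrite eval_mvpolyX (bigD1 i) //= mxE eqxx mulrC; congr (_ * _).
by apply: eq_bigr => j /negPf ji; rewrite mxE ji.
Qed.

Lemma eval_set_coord_horner {R : realType} {n : nat} (p : mvpoly R n) x i :
  exists P : {poly R},
    (fun t => eval_mvpoly p (set_coord x i t)) = horner P.
Proof.
elim/mpoly.mpolyind: p => [|c m p _ _ [P HP]].
  by exists 0; apply/funext => t; rewrite eval_mvpoly0 horner0.
exists ((c * \prod_(j | j != i) x ord0 j ^+ m j) *: 'X^(m i) + P).
apply/funext => t; rewrite eval_mvpolyP monomial_set_coord hornerD hornerZ hornerXn.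
by rewrite -HP mulrA.
Qed.

Lemma eval_set_coord_integrable {R : realType} {n : nat} (p : mvpoly R n)
    x i (a b : R) :
  (@lebesgue_measure R).-integrable `[a, b]%classic
    (EFin \o (fun t => eval_mvpoly p (set_coord x i t))).
Proof.
have [P ->] := eval_set_coord_horner p x i.
apply: continuous_compact_integrable; first exact: segment_compact.
by apply: continuous_subspaceT => t; exact: continuous_horner.
Qed.

Lemma slab_integralP {R : realType} {n : nat} (D : 'rV[R]_n) i c
    (p r : mvpoly R n) x :
  slab_integral D i (eval_mvpoly (c *: p + r)) x =
  c * slab_integral D i (eval_mvpoly p) x + slab_integral D i (eval_mvpoly r) x.
Proof.
rewrite /slab_integral -RintegralZl //; last exact: eval_set_coord_integrable.
rewrite -RintegralD //; last exact: eval_set_coord_integrable.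
  by apply: eq_Rintegral => t _; rewrite eval_mvpolyP.
rewrite (_ : EFin \o _ =
    EFin \o (fun t => eval_mvpoly (c *: p + 0) (set_coord x i t))).
  exact: eval_set_coord_integrable.
by apply/funext => t /=; rewrite eval_mvpolyP eval_mvpoly0 addr0.
Qed.

(** Integrating out one variable of a polynomial leaves a polynomial.  This is
what makes the iterated integral tractable: the function to integrate is
continuous at every stage without any theorem on parametric integrals. *)
Lemma slab_integral_mvpoly {R : realType} {n : nat} (D : 'rV[R]_n) i
    (p : mvpoly R n) :
  exists p', slab_integral D i (eval_mvpoly p) = eval_mvpoly p'.
Proof.
elim/mpoly.mpolyind: p => [|c m p _ _ [p' Hp]].
  exists 0; apply/funext => x; rewrite eval_mvpoly0 /slab_integral.
  under eq_Rintegral do rewrite eval_mvpoly0.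
  by rewrite Rintegral_cst // mul0r.
(* Integrating the monomial [m] in [x_i] replaces the factor [x_i ^ m i] by a
   constant [k] and leaves the other factors, which form the monomial [m']. *)
set h := D ord0 i / 2.
pose k := Rintegral lebesgue_measure `[- h, h]%classic (fun t : R => t ^+ m i).
pose m' := mpoly.Multinom [tuple (if j == i then 0%N else m j) | j < n].
exists ((c * k) *: mpoly.mpolyX R m' + p'); apply/funext => x.
rewrite slab_integralP eval_mvpolyP Hp -mulrA; congr (_ * _ + _).
rewrite eval_mvpolyX (bigD1 i) //= mpoly.mnmE eqxx expr0 mul1r.
rewrite (eq_bigr (fun j => x ord0 j ^+ m j)); last first.
  by move=> j /negPf ji; rewrite mpoly.mnmE ji.
rewrite /slab_integral; under eq_Rintegral do rewrite monomial_set_coord.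
rewrite RintegralZl //; first by rewrite [RHS]mulrC.
apply: continuous_compact_integrable; first exact: segment_compact.
by apply: continuous_subspaceT => t; exact: exprn_continuous.
Qed.

Lemma foldr_slab_mvpoly {R : realType} {n : nat} (D : 'rV[R]_n) s
    (p : mvpoly R n) :
  exists p', foldr (slab_integral D) (eval_mvpoly p) s = eval_mvpoly p'.
Proof.
elim: s => [|i s [p' /= ->]]; first by exists p.
exact: slab_integral_mvpoly.
Qed.

Lemma foldr_slabP {R : realType} {n : nat} (D : 'rV[R]_n) s c
    (p r : mvpoly R n) x :
  foldr (slab_integral D) (eval_mvpoly (c *: p + r)) s x =
  c * foldr (slab_integral D) (eval_mvpoly p) s x
  + foldr (slab_integral D) (eval_mvpoly r) s x.
Proof.
elim: s x => [|i s IH] x /=; first exact: eval_mvpolyP.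
have [p' Hp] := foldr_slab_mvpoly D s p.
have [r' Hr] := foldr_slab_mvpoly D s r.
rewrite (_ : foldr _ _ s = eval_mvpoly (c *: p' + r')).
  by rewrite slab_integralP Hp Hr.
by apply/funext => y; rewrite IH Hp Hr eval_mvpolyP.
Qed.

Lemma cell_integralP {R : realType} {n : nat} (D : 'rV[R]_n) c
    (p r : mvpoly R n) :
  cell_integral D (eval_mvpoly (c *: p + r)) =
  c * cell_integral D (eval_mvpoly p) + cell_integral D (eval_mvpoly r).
Proof. exact: foldr_slabP. Qed.

Lemma cell_integral_ge0 {R : realType} {n : nat} (D : 'rV[R]_n) f :
  (forall x, 0 <= f x) -> 0 <= cell_integral D f.
Proof.
rewrite /cell_integral => f0; move: (0 : 'rV_n).
elim: (enum _) => [|i s IH] x //=.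
by apply: Rintegral_ge0 => t _; apply: IH.
Qed.

Lemma unit_cell_integral_cst {R : realType} {n : nat} (c : R) :
  cell_integral (unit_cell : 'rV[R]_n) (fun=> c) = c.
Proof.
rewrite /cell_integral; move: (0 : 'rV_n).
elim: (enum _) => [|i s IH] x //=.
under eq_Rintegral do rewrite IH.
rewrite Rintegral_cst //= lebesgue_measure_itv /= mxE lte_fin.
rewrite ifT; last by rewrite gtrN // divr_gt0.
by rewrite -EFinD /= opprK -splitr mulr1.
Qed.

(** The unit cell has volume 1, so this is the positivity of the integral of
[(p - c) ^ 2], where [c] is the mean of [p]. *)
Lemma unit_cell_jensen {R : realType} {n : nat} (p : mvpoly R n) :
  cell_integral unit_cell (eval_mvpoly p) ^+ 2 <=
  cell_integral unit_cell (fun x => eval_mvpoly p x ^+ 2).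
Proof.
set c := cell_integral _ (eval_mvpoly p).
have p2E : (fun x => eval_mvpoly p x ^+ 2) = eval_mvpoly (p * p).
  by apply/funext => x; rewrite eval_mvpolyM.
rewrite p2E -subr_ge0.
have -> : cell_integral unit_cell (eval_mvpoly (p * p)) - c ^+ 2 =
  cell_integral unit_cell (eval_mvpoly
    ((- (c *+ 2)) *: p + (1 *: (p * p) + mpoly.mpolyC n (c ^+ 2)))).
  rewrite !cell_integralP -/c.
  rewrite (_ : eval_mvpoly (mpoly.mpolyC n _) = fun=> c ^+ 2); last first.
    by apply/funext => x; rewrite eval_mvpolyC.
  rewrite unit_cell_integral_cst mul1r addrCA; congr (_ + _).
  by rewrite mulNr mulrnAl -expr2 mulr2n opprD addrNK.
apply: cell_integral_ge0 => x.
rewrite !eval_mvpolyP eval_mvpolyM eval_mvpolyC mul1r.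
set y := eval_mvpoly p x; rewrite (_ : _ + _ = (y - c) ^+ 2) ?sqr_ge0 //.
rewrite sqrrB -expr2 addrA; congr (_ + _); rewrite addrC; congr (_ + _).
by rewrite mulNr mulrnAl mulrC.
Qed.

(** * Polynomials with prescribed averaged derivatives on the unit cell *)

Lemma cell_pow_unit {R : realType} {n : nat} (e : 'I_n -> int) :
  cell_pow (unit_cell : 'rV[R]_n) e = 1.
Proof. by rewrite /cell_pow big1 // => i _; rewrite mxE exp1rz. Qed.

Lemma vec_poly_unitE {R : realType} {n : nat} (p : mvpoly R n) a :
  vec_poly unit_cell p a =
  cell_integral unit_cell (eval_mvpoly (mpoly.mderivm a p)).
Proof. by rewrite /vec_poly cell_pow_unit mul1r. Qed.

Lemma vec_poly_unitP {R : realType} {n : nat} c (p r : mvpoly R n) a :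
  vec_poly unit_cell (c *: p + r) a =
  c * vec_poly unit_cell p a + vec_poly unit_cell r a.
Proof.
by rewrite !vec_poly_unitE mpoly.mderivmD mpoly.mderivmZ cell_integralP.
Qed.

Lemma vec_poly_unit0 {R : realType} {n : nat} (a : mindex n) :
  vec_poly unit_cell (0 : mvpoly R n) a = 0.
Proof.
rewrite vec_poly_unitE raddf0 -[RHS](@unit_cell_integral_cst R n 0) /=.
by congr cell_integral; apply/funext => x; rewrite eval_mvpoly0.
Qed.

(** The coefficient of the [a]-th derivative of the monomial [m]: a multi-index
[m] other than [a] of no larger degree has an entry below that of [a]. *)
Lemma ffact_mindex_eq0 {n : nat} (m a : mindex n) :
  (mdegree m <= mdegree a)%N -> m != a ->
  (\prod_(i < n) (m i) ^_ (a i))%N = 0%N.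
Proof.
move=> ma neq; have [le_am|/forallPn /= [i]] := boolP (mpoly.lem a m).
  have := mpoly.submK le_am => /(congr1 (@mpoly.mdeg n)).
  rewrite mpoly.mdegD => dE; move: ma; rewrite -dE -{2}[mdegree a]add0n.
  rewrite leq_add2r leqn0 mpoly.mdeg_eq0 => /eqP ma0.
  by move: neq; rewrite -(mpoly.submK le_am) ma0 mpoly.add0m eqxx.
by rewrite -ltnNge => lt_ma; rewrite (bigD1 i) //= ffact_small.
Qed.

(** The triangularity behind [vec_poly_unit_surj]: the diagonal entries are
the factorials [m!], and monomials of the same degree do not interact. *)
Lemma vec_poly_unitX {R : realType} {n : nat} (m a : mindex n) :
  (mdegree m <= mdegree a)%N ->
  vec_poly unit_cell (mpoly.mpolyX R m) a =
  (\prod_(i < n) (m i)`!)%:R *+ (m == a).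
Proof.
move=> ma; have [->|neq] := eqVneq m a; last first.
  rewrite vec_poly_unitE mpoly.mderivmX ffact_mindex_eq0 // scale0r.
  rewrite -[RHS](@unit_cell_integral_cst R n 0) /=.
  by congr cell_integral; apply/funext => x; rewrite eval_mvpoly0.
rewrite vec_poly_unitE mpoly.mderivmX mulr1n -[RHS](@unit_cell_integral_cst R n).
congr cell_integral; apply/funext => x.
rewrite /eval_mvpoly mpoly.mevalZ mpoly.mevalX.
rewrite [X in _ * X]big1 => [|i _].
  by rewrite mulr1; congr (_%:R); apply: eq_bigr => i _; rewrite ffactnn.
by rewrite mpoly.mnmE subnn.
Qed.

Lemma mderivm_eq0 {R : realType} {n : nat} (p : mvpoly R n) (a : mindex n) :
  (size_mvpoly p <= mdegree a)%N -> mpoly.mderivm a p = 0.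
Proof.
move=> pa; rewrite mpoly.mderivmE big1_seq // => m /andP[_ /mpoly.msize_mdeg_lt].
move=> /leq_trans /(_ pa) ma; rewrite ffact_mindex_eq0 ?mulr0 ?scale0r //.
  exact: ltnW.
by apply: contraTneq ma => ->; rewrite ltnn.
Qed.

Lemma vec_poly_unit_small {R : realType} {n : nat} (p : mvpoly R n) a :
  (size_mvpoly p <= mdegree a)%N -> vec_poly unit_cell p a = 0.
Proof.
move=> /mderivm_eq0 p0; rewrite -[RHS](@vec_poly_unit0 R _ a).
by rewrite !vec_poly_unitE p0 raddf0.
Qed.

Lemma vec_poly_unit_sum {R : realType} {n : nat} (I : finType) (P : pred I)
    (F : I -> mvpoly R n) a :
  vec_poly unit_cell (\sum_(i | P i) F i) a =
  \sum_(i | P i) vec_poly unit_cell (F i) a.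
Proof.
apply: (big_morph (fun p => vec_poly unit_cell p a)) => [p r|].
  by rewrite -{1}[p]scale1r vec_poly_unitP mul1r.
exact: vec_poly_unit0.
Qed.

(** Back substitution from the top degree downwards: the monomials of degree
[d] are fitted first, and their contribution to lower orders is subtracted
from the target. *)
Lemma vec_poly_unit_surj {R : realType} {n : nat} d (v : mindex n -> R) :
  exists2 p : mvpoly R n, (size_mvpoly p <= d)%N &
    forall a, (mdegree a < d)%N -> vec_poly unit_cell p a = v a.
Proof.
elim: d v => [|d IH] v; first by exists 0; rewrite ?mpoly.mmeasure0.
pose top := \sum_(m : bmindex n d.+1 | mdegree m == d)
  (v m / (\prod_(i < n) (m i)`!)%:R) *: mpoly.mpolyX R m.
have topE a : mdegree a = d -> vec_poly unit_cell top a = v a.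
  move=> ad; have lt_ad : (mdegree a < d.+1)%N by rewrite ad.
  rewrite vec_poly_unit_sum (bigD1 (mpoly.BMultinom lt_ad)) /= ?ad //.
  rewrite -[_ *: _]addr0 vec_poly_unitP vec_poly_unit0 addr0.
  rewrite vec_poly_unitX // eqxx mulr1n divfK; last first.
    by rewrite pnatr_eq0 -lt0n prodn_gt0 // => i; exact: fact_gt0.
  rewrite big1 ?addr0 // => m /andP[/eqP md]; rewrite mpoly.bmeqP /= => ma.
  rewrite -[_ *: _]addr0 vec_poly_unitP vec_poly_unit0 addr0.
  by rewrite vec_poly_unitX ?md ?ad // (negPf ma) mulr0.
have [p psize pE] := IH (fun a => v a - vec_poly unit_cell top a).
exists (1 *: top + p) => [|a].
  rewrite scale1r (leq_trans (mpoly.msizeD_le _ _)) // geq_max.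
  rewrite (leq_trans psize) // andbT (leq_trans (mpoly.msize_sum _ _ _)) //.
  apply/bigmax_leqP => m /eqP md.
  by rewrite (leq_trans (mpoly.msizeZ_le _ _)) // mpoly.msizeX md.
rewrite ltnS leq_eqVlt vec_poly_unitP mul1r => /predU1P[ad|/pE ->].
  by rewrite (topE _ ad) vec_poly_unit_small ?addr0 // ad.
by rewrite addrC subrK.
Qed.

(** When [a] has at least the size of [p], it does not index the sum that
defines the indicator, but then the [a]-th derivative of [p] is 0. *)
Lemma smoothness_indicator_unit_ge {R : realType} {n : nat} (p : mvpoly R n)
    (a : mindex n) : (0 < mdegree a)%N ->
  vec_poly unit_cell p a ^+ 2 <= smoothness_indicator unit_cell p.
Proof.
move=> a0; have term_ge0 (b : mindex n) :
    0 <= cell_integral unit_cell (fun x => eval_mvpoly (mpoly.mderivm b p) x ^+ 2).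
  by apply: cell_integral_ge0 => x; exact: sqr_ge0.
have [le_pa|lt_ap] := leqP (size_mvpoly p) (mdegree a).
  rewrite vec_poly_unit_small // expr0n /=; apply: sumr_ge0 => b _.
  by rewrite cell_pow_unit mul1r.
rewrite /smoothness_indicator (bigD1 (mpoly.BMultinom lt_ap)) //=.
rewrite cell_pow_unit mul1r vec_poly_unitE -[leLHS]addr0.
apply: lerD; first exact: unit_cell_jensen.
by apply: sumr_ge0 => b _; rewrite cell_pow_unit mul1r.
Qed.

(** * Positivity of the matrix of the indicator *)

Definition bilin_form {R : realType} {n d : nat}
    (C : bmindex n d.+1 -> bmindex n d.+1 -> R) (v w : mindex n -> R) : R :=
  \sum_(a : bmindex n d.+1) v a * \sum_(b : bmindex n d.+1) C a b * w b.

Lemma bilin_formP {R : realType} {n d : nat}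
    (C : bmindex n d.+1 -> bmindex n d.+1 -> R) t v v' w :
  bilin_form C (fun a => t * v a + v' a) w =
  t * bilin_form C v w + bilin_form C v' w.
Proof.
rewrite /bilin_form mulr_sumr -big_split /=; apply: eq_bigr => a _.
by rewrite mulrDl mulrA.
Qed.

Lemma bilin_form_sym {R : realType} {n d : nat}
    (C : bmindex n d.+1 -> bmindex n d.+1 -> R) v w :
  (forall a b, C a b = C b a) -> bilin_form C v w = bilin_form C w v.
Proof.
move=> symC; rewrite /bilin_form.
under eq_bigr do rewrite mulr_sumr; rewrite exchange_big /=.
apply: eq_bigr => b _; rewrite mulr_sumr; apply: eq_bigr => a _.
by rewrite symC mulrCA [RHS]mulrCA [v a * _]mulrC.
Qed.

Lemma quad_formP {R : realType} {n d : nat}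
    (C : bmindex n d.+1 -> bmindex n d.+1 -> R) t v w :
  (forall a b, C a b = C b a) ->
  quad_form C (fun a => t * v a + w a) =
  t ^+ 2 * quad_form C v + (t * bilin_form C v w) *+ 2 + quad_form C w.
Proof.
move=> symC; rewrite -[LHS]/(bilin_form _ _ _) bilin_formP.
rewrite !(bilin_form_sym C _ (fun a => t * v a + w a)) // !bilin_formP.
rewrite mulrDr mulrA -expr2 (bilin_form_sym C w v) //.
by rewrite mulr2n -!addrA.
Qed.

Lemma eq_quad_form {R : realType} {n d : nat}
    (C : bmindex n d.+1 -> bmindex n d.+1 -> R) v w :
  (forall a, (mdegree a <= d)%N -> v a = w a) ->
  quad_form C v = quad_form C w.
Proof.
move=> vw; apply: eq_bigr => a _; rewrite vw -1?ltnS ?mpoly.bmdeg //.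
congr (_ * _); apply: eq_bigr => b _.
by rewrite vw -1?ltnS ?mpoly.bmdeg.
Qed.

Lemma unit_cell_positive {R : realType} {n : nat} :
  positive_cell (unit_cell : 'rV[R]_n).
Proof. by move=> i; rewrite mxE. Qed.

(** [C] is the same matrix for all cells, so its positivity can be tested on the
unit cell, where every [v] is the vector of a polynomial. *)
Lemma quad_form_ge_sqr {R : realType} {n d : nat}
    (C : bmindex n d.+1 -> bmindex n d.+1 -> R) v (a : mindex n) :
  indicator_matrix C -> (1 <= mdegree a <= d)%N ->
  v a ^+ 2 <= quad_form C v.
Proof.
move=> [_ _ CE] /andP[a1 ad].
have [p psize pE] := vec_poly_unit_surj d.+1 v.
rewrite -(@eq_quad_form _ _ _ C (vec_poly unit_cell p) v); last exact: pE.
rewrite -CE //; last exact: unit_cell_positive.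
by rewrite -pE ?ltnS //; exact: smoothness_indicator_unit_ge.
Qed.

(** Otherwise the quadratic form would be affine and non-constant along
[t |-> t v + w], hence negative somewhere. *)
Lemma psd_bilin_form_eq0 {R : realType} {n d : nat}
    (C : bmindex n d.+1 -> bmindex n d.+1 -> R) v w :
  (forall a b, C a b = C b a) -> (forall v, 0 <= quad_form C v) ->
  quad_form C v = 0 -> bilin_form C v w = 0.
Proof.
move=> symC psdC v0; apply/eqP/contraT => B0.
set B := bilin_form C v w in B0 *.
(* At this [t] the affine function [2 t B + quad_form C w] is -1. *)
have := psdC (fun a => (- (quad_form C w + 1) / (B *+ 2)) * v a + w a).
rewrite quad_formP // v0 mulr0 add0r -/B -mulrnAr divfK ?mulrn_eq0 //.
by rewrite opprD addrAC addNr add0r lerNr oppr0 ler10.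
Qed.

Lemma bilin_form_delta {R : realType} {n d : nat}
    (C : bmindex n d.+1 -> bmindex n d.+1 -> R) (a b : bmindex n d.+1) :
  bilin_form C (fun m => (m == a)%:R) (fun m => (m == b)%:R) = C a b.
Proof.
rewrite /bilin_form (bigD1 a) //= eqxx mul1r.
rewrite [X in _ + X]big1 ?addr0 => [|c /negPf ca].
  rewrite (bigD1 b) //= eqxx mulr1 [X in _ + X]big1 ?addr0 // => c /negPf cb.
  by rewrite -mpoly.bmeqP cb mulr0.
by rewrite -mpoly.bmeqP ca mul0r.
Qed.

(** The basis vector at the multi-index 0 is the vector of the constant
polynomial 1, whose indicator is 0. *)
Lemma indicator_matrix_row0 {R : realType} {n d : nat}
    (C : bmindex n d.+1 -> bmindex n d.+1 -> R) (a b : bmindex n d.+1) :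
  indicator_matrix C -> mdegree a = 0%N -> C a b = 0.
Proof.
move=> [symC psdC CE] a0; rewrite -bilin_form_delta.
apply: psd_bilin_form_eq0 => //.
have aE : (a : mindex n) = mpoly.mnm0 by apply/eqP; rewrite -mpoly.mdeg_eq0 a0.
have := CE unit_cell (mpoly.mpolyX R (mpoly.mnm0 : mindex n)).
rewrite mpoly.msizeX mpoly.mdeg0 => /(_ unit_cell_positive isT) IE.
rewrite (@eq_quad_form _ _ _ _ _ (vec_poly unit_cell (mpoly.mpolyX R mpoly.mnm0))).
  rewrite -IE /smoothness_indicator big_pred0 // => m.
  have := mpoly.bmdeg m; rewrite {2}mpoly.msizeX mpoly.mdeg0.
  by case: (mdegree m).
move=> m _; rewrite vec_poly_unitX ?mpoly.mdeg0 // aE eq_sym.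
by rewrite big1 // => i _; rewrite mpoly.mnmE.
Qed.

(** * Orders of magnitude in the diameter *)

(** The big O relation to powers of the diameter, with its constant exposed and
without the norm on the right, so that bounds multiply directly. *)
Definition diam_bigO {R : realType} {n : nat} (F : set_system 'rV[R]_n)
    (k : nat) (f : 'rV[R]_n -> R) : Prop :=
  exists2 K, 0 < K & \forall D \near F, `|f D| <= K * diameter D ^+ k.

Lemma diameter_ge0 {R : realType} {n : nat} (D : 'rV[R]_n) : 0 <= diameter D.
Proof. exact: sqrtr_ge0. Qed.

Lemma diam_bigOP {R : realType} {n : nat} (F : filter_on 'rV[R]_n) k
    (f : 'rV[R]_n -> R) :
  f =O_F (fun D => diameter D ^+ k) <-> diam_bigO F k f.
Proof.
have E D : `|diameter D ^+ k| = diameter D ^+ k.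
  by rewrite ger0_norm // exprn_ge0 // diameter_ge0.
rewrite eqO_exP; split=> -[K K0 H]; exists K => //; apply: filterS H => D;
  by rewrite E.
Qed.

Lemma diam_bigO_near {R : realType} {n : nat} (F : filter_on 'rV[R]_n) k
    (f g : 'rV[R]_n -> R) :
  (\forall D \near F, f D = g D) -> diam_bigO F k g -> diam_bigO F k f.
Proof.
by move=> fg [K K0 H]; exists K => //; apply: filterS2 fg H => D ->.
Qed.

Lemma diam_bigO0 {R : realType} {n : nat} (F : filter_on 'rV[R]_n) k :
  diam_bigO F k (fun=> 0).
Proof.
exists 1 => //; apply: nearW => D.
by rewrite normr0 mul1r exprn_ge0 ?diameter_ge0.
Qed.

Lemma diam_bigOD {R : realType} {n : nat} (F : filter_on 'rV[R]_n) k
    (f g : 'rV[R]_n -> R) :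
  diam_bigO F k f -> diam_bigO F k g -> diam_bigO F k (fun D => f D + g D).
Proof.
move=> [K K0 fK] [L L0 gL]; exists (K + L); first exact: addr_gt0.
apply: filterS2 fK gL => D fK gL.
by rewrite (le_trans (ler_normD _ _)) // mulrDl lerD.
Qed.

Lemma diam_bigO_sum {R : realType} {n : nat} (F : filter_on 'rV[R]_n) k
    (I : finType) (P : pred I) (f : I -> 'rV[R]_n -> R) :
  (forall i, P i -> diam_bigO F k (f i)) ->
  diam_bigO F k (fun D => \sum_(i | P i) f i D).
Proof.
move=> fO; rewrite (_ : (fun D => _) = \sum_(i | P i) f i); last first.
  by apply/funext => D; rewrite fct_sumE.
elim/big_ind: _ => [|g h|]; [exact: diam_bigO0|exact: diam_bigOD|exact: fO].
Qed.

Lemma diam_bigOM {R : realType} {n : nat} (F : filter_on 'rV[R]_n) k l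
    (f g : 'rV[R]_n -> R) :
  diam_bigO F k f -> diam_bigO F l g ->
  diam_bigO F (k + l) (fun D => f D * g D).
Proof.
move=> [K K0 fK] [L L0 gL]; exists (K * L); first exact: mulr_gt0.
apply: filterS2 fK gL => D fK gL.
by rewrite normrM exprD mulrACA ler_pM.
Qed.

Lemma diam_bigOZ {R : realType} {n : nat} (F : filter_on 'rV[R]_n) k c
    (f : 'rV[R]_n -> R) :
  diam_bigO F k f -> diam_bigO F k (fun D => c * f D).
Proof.
rewrite -[in X in _ -> X](add0n k); apply: diam_bigOM.
exists (`|c| + 1); first by rewrite ltr_wpDl.
by apply: nearW => D; rewrite expr0 mulr1 lerDl.
Qed.

Lemma near_diameter_lt {R : realType} {n : nat} (F : filter_on 'rV[R]_n) (e : R) :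
  diameter D @[D --> F] --> (0 : R) -> 0 < e ->
  \forall D \near F, diameter D < e.
Proof. by move=> F0 e0; exact: (cvgr_lt _ F0). Qed.

Lemma diam_bigOW {R : realType} {n : nat} (F : filter_on 'rV[R]_n) k l
    (f : 'rV[R]_n -> R) :
  diameter D @[D --> F] --> (0 : R) -> (k <= l)%N ->
  diam_bigO F l f -> diam_bigO F k f.
Proof.
move=> F0 kl [K K0 fK]; exists K => //.
apply: filterS2 fK (near_diameter_lt _ 1 F0 ltr01) => D fK D1.
apply: (le_trans fK); rewrite ler_pM2l //.
by rewrite ler_wiXn2l ?diameter_ge0 // ltW.
Qed.

Lemma side_le_diameter {R : realType} {n : nat} (D : 'rV[R]_n) i :
  D ord0 i <= diameter D.
Proof.
rewrite (le_trans (ler_norm _)) // -sqrtr_sqr; apply: ler_wsqrtr.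
by rewrite (bigD1 i) //= lerDl sumr_ge0 // => j _; exact: sqr_ge0.
Qed.

Lemma diameter_le_side {R : realType} {n : nat} (D : 'rV[R]_n) (kappa : R) i :
  positive_cell D -> (forall i j, D ord0 i <= kappa * D ord0 j) ->
  diameter D <= Num.sqrt (n%:R * kappa ^+ 2) * D ord0 i.
Proof.
move=> Dpos Dk; rewrite -[D ord0 i in leRHS](gtr0_norm (Dpos i)) -sqrtr_sqr.
rewrite -sqrtrM; last by rewrite mulr_ge0 ?ler0n ?sqr_ge0.
apply: ler_wsqrtr; rewrite -mulrA -exprMn.
have -> : n%:R * (kappa * D ord0 i) ^+ 2 =
    \sum_(j < n) (kappa * D ord0 i) ^+ 2.
  by rewrite sumr_const card_ord mulr_natl.
apply: ler_sum => j _; apply: lerXn2r; rewrite ?nnegrE ?(ltW (Dpos j)) //.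
by rewrite (le_trans _ (Dk j i)) // ltW.
Qed.

(** * Size of the Taylor averages *)

Lemma cell_pow_natE {R : realType} {n : nat} (D : 'rV[R]_n) (m : mindex n) :
  cell_pow D (fun i => (m i)%:Z) = \prod_i D ord0 i ^+ m i.
Proof. by []. Qed.

Lemma cell_pow_le {R : realType} {n : nat} (D : 'rV[R]_n) (m : mindex n) :
  positive_cell D ->
  0 <= cell_pow D (fun i => (m i)%:Z) <= diameter D ^+ mdegree m.
Proof.
move=> Dpos; rewrite cell_pow_natE mpoly.mdegE -prodrXr prodr_ge0 => [|i _].
  apply: ler_prod => i _; apply/andP; split; first by rewrite exprn_ge0 // ltW.
  apply: lerXn2r; rewrite ?nnegrE ?diameter_ge0 ?side_le_diameter //.
  by rewrite ltW.
by rewrite exprn_ge0 // ltW.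
Qed.

Lemma cell_pow_ge {R : realType} {n : nat} (D : 'rV[R]_n) (m : mindex n) (c : R) :
  positive_cell D -> 0 <= c -> (forall i, c * diameter D <= D ord0 i) ->
  c ^+ mdegree m * diameter D ^+ mdegree m <= cell_pow D (fun i => (m i)%:Z).
Proof.
move=> Dpos c0 cD; rewrite cell_pow_natE -exprMn mpoly.mdegE -prodrXr.
have rho0 := diameter_ge0 D.
apply: ler_prod => i _; apply/andP; split; first by rewrite exprn_ge0 ?mulr_ge0.
by apply: lerXn2r; rewrite ?nnegrE ?mulr_ge0 ?(ltW (Dpos i)).
Qed.

Lemma cell_pow_bigO {R : realType} {n : nat} (F : filter_on 'rV[R]_n)
    (m : mindex n) :
  (\forall D \near F, positive_cell D) ->
  diam_bigO F (mdegree m) (fun D => cell_pow D (fun i => (m i)%:Z)).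
Proof.
move=> Fpos; exists 1 => //; apply: filterS Fpos => D /(@cell_pow_le _ _ _ m).
by case/andP => m0 mD; rewrite mul1r ger0_norm.
Qed.

(** The terms are selected by an arbitrary [P]: the even [b] for the upper bound,
and the nonzero even [b] for the error in the lower bound. *)
Lemma taylor_sum_bigO {R : realType} {n : nat} (F : filter_on 'rV[R]_n)
    (u : 'rV[R]_n -> R) (M k : nat) (a : mindex n) (P : pred (mindex n)) :
  (\forall D \near F, positive_cell D) ->
  diameter D @[D --> F] --> (0 : R) ->
  (forall b, P b -> (mdegree (mpoly.mnm_add a b) < k)%N ->
     pderivm (mpoly.mnm_add a b) u 0 = 0) ->
  diam_bigO F k (fun D =>
    \sum_(b : bmindex n (M - mdegree a).+1 | P b)
      pderivm (mpoly.mnm_add a b) u 0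
      / (2 ^+ mdegree b * (\prod_i ((b i).+1)`!)%:R)
      * cell_pow D (fun i => (a i + b i)%:Z)).
Proof.
move=> Fpos F0 u0; apply: diam_bigO_sum => b Pb.
have [lt_k|ge_k] := ltnP (mdegree (mpoly.mnm_add a b)) k.
  apply: (diam_bigO_near _ _ _ (fun=> 0)); last exact: diam_bigO0.
  by apply: nearW => D; rewrite u0 // !mul0r.
apply: diam_bigOZ; apply: diam_bigOW ge_k _ => //.
apply: diam_bigO_near (cell_pow_bigO _ (mpoly.mnm_add a b) Fpos).
by apply: nearW => D; apply: eq_bigr => i _; rewrite mpoly.mnmDE.
Qed.

(** The term [b = 0] dominates: it is of exact order [|a|], since the bounded
aspect ratio makes every side comparable to the diameter, and the other terms
are of order at least [|a| + 1]. *)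
Lemma taylor_average_ge {R : realType} {n : nat} (F : filter_on 'rV[R]_n)
    (u : 'rV[R]_n -> R) (M : nat) (a : mindex n) :
  (\forall D \near F, positive_cell D) ->
  diameter D @[D --> F] --> (0 : R) ->
  bounded_aspect_ratio F -> pderivm a u 0 != 0 ->
  exists2 c, 0 < c & \forall D \near F,
    c * diameter D ^+ mdegree a <= `|taylor_average u M D a|.
Proof.
move=> Fpos F0 [kappa Fk] ua0.
(* The summand 1 makes [s] positive, since the aspect ratio alone does not
   exclude a zero square root. *)
pose s := Num.sqrt (n%:R * kappa ^+ 2) + 1.
have s0 : 0 < s by rewrite ltr_wpDl ?sqrtr_ge0.
pose A := `|pderivm a u 0| * s^-1 ^+ mdegree a.
have A0 : 0 < A by rewrite mulr_gt0 ?normr_gt0 // exprn_gt0 // invr_gt0.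
pose rest := fun b : mindex n => evenm b && (b != mpoly.mnm0).
have [b brest|K K0 restK] :=
    @taylor_sum_bigO _ _ F u M (mdegree a).+1 a rest Fpos F0.
  have /andP[_] := brest; rewrite -mpoly.mdeg_eq0 mpoly.mdegD ltnS.
  by rewrite -[leqRHS]addn0 leq_add2l leqn0 => /negPf->.
exists (A / 2); first by rewrite divr_gt0.
have small : 0 < A / 2 / K by rewrite !divr_gt0.
near=> D.
have Dpos : positive_cell D by near: D.
have Dk : forall i j, D ord0 i <= kappa * D ord0 j by near: D.
have Dsmall : diameter D < A / 2 / K by near: D; exact: near_diameter_lt.
have rho0 := diameter_ge0 D.
have sD i : s^-1 * diameter D <= D ord0 i.
  rewrite ler_pdivrMl // (le_trans (diameter_le_side _ _ i Dpos Dk)) //.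
  by rewrite ler_wpM2r ?(ltW (Dpos i)) // lerDl.
have even0 : evenm (mpoly.bm0 : bmindex n (M - mdegree a).+1).
  by apply/forallP => i; rewrite mpoly.mnmE.
rewrite /taylor_average (bigD1 mpoly.bm0) //=.
set lead := (X in `|X + _|); set r := (X in `|_ + X|).
have leadE : lead = pderivm a u 0 * cell_pow D (fun i => (a i)%:Z).
  rewrite /lead mpoly.addm0 mpoly.mdeg0 expr0 mul1r big1 ?divr1.
    by congr (_ * _); apply: eq_bigr => i _; rewrite mpoly.mnmE addn0.
  by move=> i _; rewrite mpoly.mnmE.
have lead_ge : A * diameter D ^+ mdegree a <= `|lead|.
  rewrite leadE normrM /A -mulrA ler_wpM2l //.
  rewrite (le_trans _ (ler_norm _)) // cell_pow_ge // invr_ge0 ltW //.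
have r_le : `|r| <= A / 2 * diameter D ^+ mdegree a.
  have -> : r = \sum_(b : bmindex n (M - mdegree a).+1 | rest b)
      pderivm (mpoly.mnm_add a b) u 0
      / (2 ^+ mdegree b * (\prod_i ((b i).+1)`!)%:R)
      * cell_pow D (fun i => (a i + b i)%:Z).
    by [].
  apply: (@le_trans _ _ (K * diameter D ^+ (mdegree a).+1)).
    by near: D.
  rewrite exprS mulrA ler_wpM2r ?exprn_ge0 //.
  by rewrite mulrC -ler_pdivlMr // ltW.
apply: le_trans (lerB_normD _ _); rewrite lerBrDr.
by apply: le_trans lead_ge; rewrite {2}(splitr A) mulrDl lerD2l.
Unshelve. all: end_near. Qed.

(** * Estimates of B and R *)

(** Only the entries at nonzero multi-indices matter, the form being 0 on the
others; this excludes the mean of [q], which is not small. *)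
Lemma bilin_form_bigO {R : realType} {n d : nat} (F : filter_on 'rV[R]_n)
    (C : bmindex n d.+1 -> bmindex n d.+1 -> R) k l
    (v w : 'rV[R]_n -> mindex n -> R) :
  indicator_matrix C ->
  (forall a, (1 <= mdegree a <= d)%N -> diam_bigO F k (fun D => v D a)) ->
  (forall a, (1 <= mdegree a <= d)%N -> diam_bigO F l (fun D => w D a)) ->
  diam_bigO F (k + l) (fun D => bilin_form C (v D) (w D)).
Proof.
move=> hC vO wO; have [symC _ _] := hC.
have bm_le (a : bmindex n d.+1) : (mdegree a <= d)%N.
  by rewrite -ltnS mpoly.bmdeg.
apply: (diam_bigO_near _ _ _
    (fun D => \sum_a \sum_b C a b * (v D a * w D b))).
  apply: nearW => D; apply: eq_bigr => a _; rewrite mulr_sumr.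
  by apply: eq_bigr => b _; rewrite mulrCA.
apply: diam_bigO_sum => a _; apply: diam_bigO_sum => b _.
have [a0|a1] := posnP (mdegree a).
  apply: (diam_bigO_near _ _ _ (fun=> 0)); last exact: diam_bigO0.
  by apply: nearW => D; rewrite (indicator_matrix_row0 C a b) // mul0r.
have [b0|b1] := posnP (mdegree b).
  apply: (diam_bigO_near _ _ _ (fun=> 0)); last exact: diam_bigO0.
  by apply: nearW => D; rewrite symC (indicator_matrix_row0 C b a) // mul0r.
by apply: diam_bigOZ; apply: diam_bigOM; [apply: vO|apply: wO];
  apply/andP; split.
Qed.

Lemma vecB_bigO {R : realType} {n : nat} (F : filter_on 'rV[R]_n)
    (u : 'rV[R]_n -> R) (M k : nat) (a : mindex n) :
  (\forall D \near F, positive_cell D) ->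
  diameter D @[D --> F] --> (0 : R) ->
  (forall m : mindex n, (1 <= mdegree m <= k)%N -> pderivm m u 0 = 0) ->
  diam_bigO F k.+1 (fun D => vecB u M D a).
Proof.
move=> Fpos F0 u0; rewrite /vecB.
case aM: (1 <= mdegree a <= M)%N; last exact: diam_bigO0.
have [a1 _] := andP aM.
apply: taylor_sum_bigO => // b _ ab; apply: u0.
by rewrite mpoly.mdegD in ab *; rewrite (leq_trans a1) ?leq_addr.
Qed.

Lemma vecB_eq0 {R : realType} {n : nat} (u : 'rV[R]_n -> R) (M : nat) D
    (a : mindex n) :
  (forall m : mindex n, (1 <= mdegree m <= M)%N -> pderivm m u 0 = 0) ->
  vecB u M D a = 0.
Proof.
move=> u0; rewrite /vecB; case: ifP => // /andP[a1 aM].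
apply: big1 => b _; rewrite u0 ?mul0r // mpoly.mdegD (leq_trans a1) ?leq_addr //=.
by rewrite -leq_subRL // -ltnS mpoly.bmdeg.
Qed.

Lemma indicatorB_bigO {R : realType} {n M d : nat} (F : filter_on 'rV[R]_n)
    (C : bmindex n d.+1 -> bmindex n d.+1 -> R) (u : 'rV[R]_n -> R) (k : nat) :
  indicator_matrix C ->
  (\forall D \near F, positive_cell D) ->
  diameter D @[D --> F] --> (0 : R) ->
  (forall m : mindex n, (1 <= mdegree m <= k)%N -> pderivm m u 0 = 0) ->
  diam_bigO F (2 * (k + 1)) (indicatorB C u M).
Proof.
move=> hC Fpos F0 u0; rewrite mul2n -addnn addn1.
by apply: bilin_form_bigO => // a _; exact: vecB_bigO.
Qed.

Lemma indicatorB_ge {R : realType} {n M d : nat} (F : filter_on 'rV[R]_n)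
    (C : bmindex n d.+1 -> bmindex n d.+1 -> R) (u : 'rV[R]_n -> R)
    (a : mindex n) :
  indicator_matrix C ->
  (\forall D \near F, positive_cell D) ->
  diameter D @[D --> F] --> (0 : R) ->
  bounded_aspect_ratio F ->
  (1 <= mdegree a <= M)%N -> (mdegree a <= d)%N -> pderivm a u 0 != 0 ->
  exists2 c, 0 < c & \forall D \near F,
    c * diameter D ^+ (2 * mdegree a) <= indicatorB C u M D.
Proof.
move=> hC Fpos F0 Far aM ad ua0.
have [c c0 cT] := taylor_average_ge F u M a Fpos F0 Far ua0.
exists (c ^+ 2); first exact: exprn_gt0.
apply: filterS cT => D cT; have [a1 _] := andP aM.
apply: le_trans (quad_form_ge_sqr C (vecB u M D) a hC _); last exact/andP.
rewrite /vecB aM mulnC exprM -exprMn -[leRHS]real_normK ?num_real //.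
apply: lerXn2r => //; rewrite nnegrE ?normr_ge0 //.
by rewrite mulr_ge0 ?exprn_ge0 ?diameter_ge0 // ltW.
Qed.

(** Up to order [M] this is the hypothesis on the averages of [q]; above, [vecB]
vanishes and the entry is that of [q] itself. *)
Lemma remainder_bigO {R : realType} {n M d : nat} (F : filter_on 'rV[R]_n)
    (u : 'rV[R]_n -> R) (q : 'rV[R]_n -> mvpoly R n) (a : mindex n) :
  (forall a : mindex n, (1 <= mdegree a <= M)%N ->
     (fun D => vec_poly D (q D) a) =
     (fun D => taylor_average u M D a) +O_F (fun D => diameter D ^+ M.+1)) ->
  (forall a : mindex n, (M < mdegree a <= d)%N ->
     (fun D => vec_poly D (q D) a) =O_F (fun D => diameter D ^+ M.+1)) ->
  (1 <= mdegree a <= d)%N ->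
  diam_bigO F M.+1 (fun D => vec_poly D (q D) a - vecB u M D a).
Proof.
move=> hq hq_high /andP[a1 ad]; rewrite /vecB a1 /=.
have [aM|Ma] := leqP (mdegree a) M.
  by apply/diam_bigOP/eqOP/eqaddOP; apply: hq; rewrite a1.
under [X in diam_bigO _ _ X]funext do rewrite subr0.
by apply/diam_bigOP/hq_high; rewrite Ma.
Qed.

(** The cross term has order [(k + 1) + (M + 1)], and the quadratic term
[2 (M + 1)] is at least that because [k <= M].  Both regimes of the critical
order are covered, with [k = M] and with [k = ncp]. *)
Lemma indicatorR_bigO {R : realType} {n M d : nat} (F : filter_on 'rV[R]_n)
    (C : bmindex n d.+1 -> bmindex n d.+1 -> R) (u : 'rV[R]_n -> R)
    (q : 'rV[R]_n -> mvpoly R n) (k : nat) :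
  indicator_matrix C ->
  (\forall D \near F, positive_cell D) ->
  diameter D @[D --> F] --> (0 : R) ->
  (\forall D \near F, (size_mvpoly (q D) <= d.+1)%N) ->
  (forall a : mindex n, (1 <= mdegree a <= d)%N ->
     diam_bigO F M.+1 (fun D => vec_poly D (q D) a - vecB u M D a)) ->
  (forall m : mindex n, (1 <= mdegree m <= k)%N -> pderivm m u 0 = 0) ->
  (k <= M)%N ->
  diam_bigO F (M + 2 + k) (fun D => indicatorR C u M D (q D)).
Proof.
move=> hC Fpos F0 Fsize wO u0 kM; have [symC _ CE] := hC.
pose w D a := vec_poly D (q D) a - vecB u M D a.
apply: (diam_bigO_near _ _ _ (fun D =>
    2 * bilin_form C (vecB u M D) (w D) + bilin_form C (w D) (w D))).
  apply: filterS2 Fpos Fsize => D Dpos Dsize.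
  rewrite /indicatorR CE // (eq_quad_form C _ (fun a => 1 * vecB u M D a + w D a)).
    rewrite quad_formP // expr1n !mul1r mulr_natl.
    by rewrite /indicatorB -[_ + _ + quad_form C (w D)]addrA [LHS]addrC addKr.
  by move=> a _; rewrite mul1r addrC subrK.
have vO (a : mindex n) : diam_bigO F k.+1 (fun D => vecB u M D a).
  exact: vecB_bigO.
apply: diam_bigOD; last first.
  apply: (diam_bigOW _ _ (M.+1 + M.+1)) => //; last exact: bilin_form_bigO.
  by rewrite -addnA [leqRHS]addSnnS leq_add2l add2n !ltnS.
apply: diam_bigOZ; rewrite (_ : M + 2 + k = k.+1 + M.+1)%N.
  exact: bilin_form_bigO.
by rewrite addSnnS addn2 addnC.
Qed.

Theorem corollary1 (R : realType) (n : nat) (hn : (0 < n)%N)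
    (M d : nat) (hM : (1 <= M)%N)
    (C : bmindex n d.+1 -> bmindex n d.+1 -> R) (hC : indicator_matrix C)
    (u : 'rV[R]_n -> R) (ncp : nat)
    (hu : Ck_near (maxn M ncp.+1) u 0) (hcp : critical_order u ncp)
    (F : filter_on 'rV[R]_n)
    (hFpos : \forall D \near F, positive_cell D)
    (hF0 : diameter D @[D --> F] --> (0 : R))
    (q : 'rV[R]_n -> mvpoly R n)
    (hdeg : \forall D \near F, (M < size_mvpoly (q D) <= d.+1)%N)
    (hq : forall a : mindex n, (1 <= mdegree a <= M)%N ->
       (fun D => vec_poly D (q D) a) =
       (fun D => taylor_average u M D a) +O_F (fun D => diameter D ^+ M.+1))
    (hq_high : forall a : mindex n, (M < mdegree a <= d)%N ->
       (fun D => vec_poly D (q D) a) =O_F (fun D => diameter D ^+ M.+1)) :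
  ((M <= ncp)%N ->
     (forall D, indicatorB C u M D = 0) /\
     (fun D => indicatorR C u M D (q D))
       =O_F (fun D => diameter D ^+ (2 * M + 2))) /\
  ((ncp < M)%N ->
     [/\ indicatorB C u M =O_F (fun D => diameter D ^+ (2 * (ncp + 1))),
         (fun D => indicatorR C u M D (q D))
           =O_F (fun D => diameter D ^+ (M + 2 + ncp))
       & bounded_aspect_ratio F ->
         (fun D => indicatorR C u M D (q D)) =o_F (indicatorB C u M)]).
Proof.
have [u0 [a ak ua0]] := hcp.
have hsize : \forall D \near F, (size_mvpoly (q D) <= d.+1)%N.
  by apply: filterS hdeg => D /andP[].
have RO k : (k <= M)%N ->
    (forall m : mindex n, (1 <= mdegree m <= k)%N -> pderivm m u 0 = 0) ->
    diam_bigO F (M + 2 + k) (fun D => indicatorR C u M D (q D)).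
  move=> kM uk0; apply: indicatorR_bigO => // b; exact: remainder_bigO.
split=> [Mncp|ncpM].
  have uM0 (m : mindex n) : (1 <= mdegree m <= M)%N -> pderivm m u 0 = 0.
    by move=> /andP[m1 mM]; rewrite u0 // m1 (leq_trans mM).
  split=> [D|].
    by apply: big1 => b _; rewrite vecB_eq0 ?mul0r.
  by apply/diam_bigOP; rewrite mul2n -addnn addnAC; exact: RO.
have RO' := RO ncp (ltnW ncpM) u0.
split=> [||Far]; first exact/diam_bigOP/indicatorB_bigO.
  exact/diam_bigOP.
apply/eqoP => e e0; have [K K0 RK] := RO'.
(* [M <= d] holds as soon as some cell satisfies the degree hypothesis; if
   none does, [F] is the improper filter and every estimate is trivial. *)
have [dM|Md] := ltnP d M.
  apply: filterS hdeg => D /andP[Mq qd].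
  by have := leq_ltn_trans dM (leq_trans Mq qd); rewrite ltnn.
have aM : (1 <= mdegree a <= M)%N by rewrite ak.
have ad : (mdegree a <= d)%N by rewrite ak (leq_trans ncpM).
have [c c0 cB] := indicatorB_ge F C u a hC hFpos hF0 Far aM ad ua0.
(* [R <= K rho ^ (2 |a| + 1)] and [c rho ^ (2 |a|) <= B], so [R <= e B] as soon
   as [rho <= e c / K]. *)
have small : 0 < e * c / K by rewrite divr_gt0 // mulr_gt0.
near=> D.
have rho0 := diameter_ge0 D.
have rho1 : diameter D <= 1.
  by apply: ltW; near: D; exact: near_diameter_lt.
have rhoS : diameter D <= e * c / K.
  by apply: ltW; near: D; exact: near_diameter_lt.
apply: (@le_trans _ _ (K * diameter D ^+ (M + 2 + ncp))); first by near: D.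
apply: (@le_trans _ _ (e * (c * diameter D ^+ (2 * mdegree a)))); last first.
  rewrite ler_pM2l // (le_trans _ (ler_norm _)) //; near: D; exact: cB.
apply: (@le_trans _ _ (K * diameter D ^+ (2 * mdegree a).+1)).
  rewrite ler_pM2l // ler_wiXn2l // ak.
  by rewrite mul2n -addnn addSnnS -addnS [leqRHS]addnC leq_add2l addn2 !ltnS.
rewrite exprS !mulrA ler_wpM2r ?exprn_ge0 //.
by rewrite mulrC -ler_pdivlMr.
Unshelve. all: end_near. Qed.
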